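(* Let $X$ be a real Hilbert space, let $U$ and $V$ be closed linear subspaces of $X$, let $T = P_V(2P_U-\mathrm{Id})+\mathrm{Id}-P_U$ be the associated Douglas--Rachford operator, and let $c_F$ be the cosine of the Friedrichs angle between $U$ and $V$. Let $n\in\{1,2,3,\ldots\}$ and let $x\in X$. Then $$\|T^n-P_{\mathrm{Fix}\, T}\| = c_F^n,\qquad \|(TT^* )^n-P_{\mathrm{Fix}\, T}\| = c_F^{2n},$$ and $$\|T^nx-P_{\mathrm{Fix}\, T}x\|\le c_F^n\|x-P_{\mathrm{Fix}\, T}x\|\le c_F^n\|x\|.$$
   Context: $X$ is a real Hilbert space (possibly infinite-dimensional) with inner product $\langle\cdot,\cdot\rangle$ and norm $\|\cdot\|$; for bounded linear operators, $\|\cdot\|$ is the operator norm and $^*$ the adjoint. For a closed subspace $W$ of $X$, $P_W$ is the orthogonal projection onto $W$ and $W^\perp$ its orthogonal complement. $\mathrm{Id}$ is the identity operator. $\mathrm{Fix}\,T=\{x\in X : Tx=x\}$, which is a closed subspace. The cosine of the Friedrichs angle between $U$ and $V$ is $$c_F = c_F(U,V) := \sup\{\langle u,v\rangle : u\in U\cap(U\cap V)^\perp,\ v\in V\cap(U\cap V)^\perp,\ \|u\|\le 1,\ \|v\|\le 1\}.$$ *)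

(* Defs.v *)
From mathcomp Require Import all_boot all_order all_algebra.
From mathcomp Require Import all_classical all_reals all_analysis.

Set Implicit Arguments.
Unset Strict Implicit.
Unset Printing Implicit Defensive.

Import Order.TTheory GRing.Theory Num.Theory.
Import numFieldNormedType.Exports.

Local Open Scope classical_set_scope.
Local Open Scope ring_scope.

(* A real Hilbert space is a complete normed module X together with a
   positive definite symmetric bilinear form ip : {dot X for idfun} inducing
   its norm. The compatibility with the norm is not part of the definitions
   below, which only use ip. *)

Definition closed_subspace (R : realType) (X : normedModType R)
    (W : set X) : Prop :=
  GRing.submod_closed (mem W) /\ closed W.

Definition orthogonal_complement (R : realType) (X : normedModType R)
    (ip : {dot X for idfun}) (W : set X) : set X :=
  [set x | forall w, W w -> ip x w = 0].

(* The unique p in W such that x - p is orthogonal to W. Such a p exists when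
   X is complete and W is a closed subspace; the default value 0 of [xget] is
   irrelevant in that case. *)
Definition orth_proj (R : realType) (X : normedModType R)
    (ip : {dot X for idfun}) (W : set X) (x : X) : X :=
  xget 0 [set p | W p /\ orthogonal_complement ip W (x - p)].

(* The unique z such that <f x, y> = <x, z> for all x. Such a z exists when
   X is complete and f is a bounded linear operator (Riesz); the default value
   0 of [xget] is irrelevant in that case. *)
Definition adjoint (R : realType) (X : normedModType R)
    (ip : {dot X for idfun}) (f : X -> X) (y : X) : X :=
  xget 0 [set z | forall x, ip (f x) y = ip x z].

Definition Fix (X : Type) (f : X -> X) : set X := [set x | f x = x].

(* The supremum is taken in the extended reals, so that an equation
   [op_norm f = c%:E] also asserts that f is bounded. *)
Definition op_norm (R : realType) (X : normedModType R) (f : X -> X) : \bar R :=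
  ereal_sup [set (`|f x|)%:E | x in [set x : X | `|x| <= 1]].

Definition friedrichs_cos (R : realType) (X : normedModType R)
    (ip : {dot X for idfun}) (U V : set X) : R :=
  let Wperp := orthogonal_complement ip (U `&` V) in
  sup [set r | exists u v : X,
    [/\ (U `&` Wperp) u, (V `&` Wperp) v, `|u| <= 1, `|v| <= 1 & r = ip u v]].

Definition douglas_rachford (R : realType) (X : normedModType R)
    (ip : {dot X for idfun}) (U V : set X) (x : X) : X :=
  orth_proj ip V (2 *: orth_proj ip U x - x) + x - orth_proj ip U x.

(* Main.v *)
(* Write p, q for the projections onto U, V. Then
   T = q p + (1 - q)(1 - p), its adjoint is the Douglas-Rachford operator of
   the pair (V, U), and |T x|^2 = |x|^2 - |p x - q x|^2 is symmetric in p and q.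
   Hence T is normal and Fix T = {x | p x = q x}. On (Fix T)^perp one has
   |T x| <= c_F |x|: the q p part is the definition of c_F, and the other part
   follows by density of (1 - p) V in the orthogonal of U^perp & V^perp within
   U^perp. The bound is approached on U, where <u, v> <= |q u| = |T u|.
   Normality makes n |-> |T^n x| log-convex, so |T x|^n <= |T^n x| for
   |x| <= 1, and the norm of T^n is the n-th power of that of T. The same
   applies to the normal operator T T^*, whose norm on (Fix T)^perp is c_F^2. *)
From HB Require Import structures.
Require Import Defs.
From mathcomp Require Import all_boot all_order all_algebra.
From mathcomp Require Import all_classical all_reals all_analysis.
From mathcomp Require Import ring lra.

Set Implicit Arguments.
Unset Strict Implicit.
Unset Printing Implicit Defensive.

Import Order.TTheory GRing.Theory Num.Theory.
Import numFieldNormedType.Exports.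

Local Open Scope classical_set_scope.
Local Open Scope ring_scope.

(** * Inner product identities and closed subspaces *)

Section InnerProduct.
Context (R : realType) (X : normedModType R) (ip : {dot X for idfun}).
Hypothesis ip_norm : forall x : X, `|x| = Num.sqrt (ip x x).
Implicit Types (x y z : X) (W : set X).

Lemma ipC x y : ip x y = ip y x.
Proof. by rewrite hermC /= expr0 mul1r. Qed.

Lemma ip0l x : ip 0 x = 0. Proof. exact: linear0l. Qed.
Lemma ip0r x : ip x 0 = 0. Proof. exact: linear0r. Qed.
Lemma ipDl x y z : ip (x + y) z = ip x z + ip y z.
Proof. exact: linearDl. Qed.
Lemma ipDr x y z : ip x (y + z) = ip x y + ip x z.
Proof. exact: linearDr. Qed.
Lemma ipNl x y : ip (- x) y = - ip x y. Proof. exact: linearNl. Qed.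
Lemma ipNr x y : ip x (- y) = - ip x y. Proof. exact: linearNr. Qed.
Lemma ipZl a x y : ip (a *: x) y = a * ip x y. Proof. exact: linearZl_LR. Qed.
Lemma ipZr a x y : ip x (a *: y) = a * ip x y. Proof. exact: linearZr_LR. Qed.

Definition ipE := (ipDl, ipDr, ipNl, ipNr, ipZl, ipZr, ip0l, ip0r).

Lemma ipxx x : ip x x = `|x| ^+ 2.
Proof.
rewrite ip_norm sqr_sqrtr//; have [->|x0] := eqVneq x 0.
  by rewrite ip0l.
exact/ltW/neq0_dnorm_gt0.
Qed.

Lemma ip_inj x y : (forall z, ip x z = ip y z) -> x = y.
Proof.
move=> xy; apply/eqP; rewrite -subr_eq0 -normr_eq0 -sqrf_eq0 -ipxx.
by rewrite ipDl ipNl xy subrr.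
Qed.

Lemma normDsq x y : `|x + y| ^+ 2 = `|x| ^+ 2 + 2 * ip x y + `|y| ^+ 2.
Proof. by rewrite -!ipxx !ipE (ipC y x); ring. Qed.

Lemma normBsq x y : `|x - y| ^+ 2 = `|x| ^+ 2 - 2 * ip x y + `|y| ^+ 2.
Proof. by rewrite normDsq normrN ipNr mulrN. Qed.

Lemma norm_eq x y : `|x| ^+ 2 = `|y| ^+ 2 -> `|x| = `|y|.
Proof. by move=> /eqP; rewrite eqrXn2// => /eqP. Qed.

Lemma cauchy_schwarz x y : ip x y <= `|x| * `|y|.
Proof.
have [->|x0] := eqVneq x 0; first by rewrite ip0l normr0 mul0r.
have [->|y0] := eqVneq y 0; first by rewrite ip0r normr0 mulr0.
(* This square expands to 2|x||y|(|x||y| - <x,y>). *)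
have := sqr_ge0 (`| `|y| *: x - `|x| *: y|).
rewrite normBsq ipZl ipZr !normrZ !normr_id => h.
have xp : 0 < `|x| by rewrite normr_gt0.
have yp : 0 < `|y| by rewrite normr_gt0.
have : 0 <= 2 * (`|x| * `|y|) * (`|x| * `|y| - ip x y).
  by move: h; congr is_true; congr (0 <= _); ring.
by rewrite pmulr_rge0 ?subr_ge0// !mulr_gt0.
Qed.

Lemma closure_normP (A : set X) x :
  closure A x <-> forall e, 0 < e -> exists2 a, A a & `|x - a| < e.
Proof.
split=> [Ax e e0|h B].
  have [a [Aa]] := Ax _ (nbhsx_ballx x e e0).
  by rewrite -ball_normE /=; exists a.
rewrite -nbhs_ballE => -[e /= e0 eB]; have [a Aa xa] := h _ e0.
by exists a; split=> //; apply: eB; rewrite -ball_normE.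
Qed.

Lemma closed_subspaceP W : closed_subspace W <->
  [/\ W 0, forall a x y, W x -> W y -> W (a *: x + y) & closed W].
Proof.
split=> [[[W0 WZD] Wc]|[W0 WZD Wc]]; split=> //.
- by move: W0; rewrite inE.
- by move=> a x y Wx Wy; have := WZD a x y; rewrite !inE; exact.
- split; first by rewrite inE.
  by move=> a x y; rewrite !inE; exact: WZD.
Qed.

Lemma closed_subspace_lin W a x y :
  closed_subspace W -> W x -> W y -> W (a *: x + y).
Proof. by move=> /closed_subspaceP[_ + _]; exact. Qed.

Lemma closed_subspace0 W : closed_subspace W -> W 0.
Proof. by move=> /closed_subspaceP[]. Qed.

Lemma closed_subspaceZ W a x : closed_subspace W -> W x -> W (a *: x).
Proof.
move=> hW Wx; rewrite -[_ *: _]addr0; apply: closed_subspace_lin => //.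
exact: closed_subspace0.
Qed.

Lemma closed_subspaceD W x y : closed_subspace W -> W x -> W y -> W (x + y).
Proof. by move=> hW Wx; rewrite -[x]scale1r; exact: closed_subspace_lin. Qed.

Lemma closed_subspaceB W x y : closed_subspace W -> W x -> W y -> W (x - y).
Proof.
move=> hW Wx Wy; rewrite -scaleN1r addrC; exact: closed_subspace_lin.
Qed.

Lemma closed_subspaceI W W' :
  closed_subspace W -> closed_subspace W' -> closed_subspace (W `&` W').
Proof.
move=> /closed_subspaceP[W0 WZ Wc] /closed_subspaceP[W'0 W'Z W'c].
apply/closed_subspaceP; split=> //; last exact: closedI.
by move=> a x y [? ?] [? ?]; split; [exact: WZ|exact: W'Z].
Qed.

Lemma closed_subspace_closure W : W 0 ->
  (forall a x y, W x -> W y -> W (a *: x + y)) -> closed_subspace (closure W).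
Proof.
move=> W0 WZD; apply/closed_subspaceP; split; last exact: closed_closure.
  exact: subset_closure.
move=> a x y /closure_normP Wx /closure_normP Wy; apply/closure_normP => e e0.
have a0 : 0 < `|a| + 1 by rewrite ltr_wpDl.
have [|x' Wx' xx'] := Wx (e / 2 / (`|a| + 1)); first by rewrite !divr_gt0.
have [|y' Wy' yy'] := Wy (e / 2); first by rewrite divr_gt0.
exists (a *: x' + y'); first exact: WZD.
have -> : a *: x + y - (a *: x' + y') = a *: (x - x') + (y - y').
  by rewrite opprD addrACA scalerBr.
rewrite (le_lt_trans (ler_normD _ _))// normrZ [ltRHS]splitr ler_ltD//.
rewrite (@le_trans _ _ ((`|a| + 1) * `|x - x'|))//.
  by rewrite ler_wpM2r// lerDl.
by rewrite mulrC -ler_pdivlMr// ltW.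
Qed.

Lemma closed_subspace_orthogonal W :
  closed_subspace (orthogonal_complement ip W).
Proof.
apply/closed_subspaceP; split.
- by move=> w _; rewrite ip0l.
- move=> a x y hx hy w Ww.
  by rewrite ipDl ipZl hx// hy// mulr0 addr0.
- move=> x /closure_normP hx w Ww; apply/eqP; rewrite -normr_le0.
  apply/ler_addgt0Pr => e e0; rewrite add0r.
  have w0 : 0 < `|w| + 1 by rewrite ltr_wpDl.
  have [|y hy xy] := hx (e / (`|w| + 1)); first by rewrite divr_gt0.
  rewrite -[x](subrK y) ipDl (hy w Ww) addr0.
  have h : `|x - y| * `|w| <= e.
    rewrite (@le_trans _ _ (`|x - y| * (`|w| + 1)))//.
      by rewrite ler_wpM2l// lerDl.
    by rewrite -ler_pdivlMr// ltW.
  rewrite ler_norml lerNl -ipNl !(le_trans (cauchy_schwarz _ _))//.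
  by rewrite normrN.
Qed.

(** For a second candidate q, the vector q - p lies in W and is also orthogonal to W, being (x - p)
    - (x - q). This evaluates the [xget] in [orth_proj]. *)
Lemma orth_proj_unique W x p : closed_subspace W ->
  W p -> orthogonal_complement ip W (x - p) -> orth_proj ip W x = p.
Proof.
move=> hW Wp xp; rewrite /orth_proj; apply: xget_unique => // q [Wq xq].
have qp : W (q - p) by exact: closed_subspaceB.
apply/eqP; rewrite -subr_eq0 -normr_eq0 -sqrf_eq0 -ipxx.
have -> : ip (q - p) (q - p) = ip (x - p) (q - p) - ip (x - q) (q - p).
  by rewrite !ipE; ring.
by rewrite xp// xq// subrr.
Qed.

(** The inner product separates points, so a formal adjoint forces linearity. This turns maps
    defined by choice into bundled linear maps. *)
Lemma adjointable_linear (f g : X -> X) :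
  (forall x y, ip (f x) y = ip x (g y)) -> exists h : {linear X -> X}, f = h.
Proof.
move=> fg; have f_lin : linear f.
  by move=> a x y; apply: ip_inj => z; rewrite fg !(ipDl, ipZl) !fg.
pose m := GRing.isLinear.Build R X X _ _ f_lin.
pose h : {linear X -> X} := HB.pack f m.
by exists h.
Qed.
End InnerProduct.

(** * Existence and properties of orthogonal projections *)

Section Projection.
Context (R : realType) (X : completeNormedModType R) (ip : {dot X for idfun}).
Hypothesis ip_norm : forall x : X, `|x| = Num.sqrt (ip x x).
Implicit Types (x y z : X) (W : set X).

(** The sets [B e] of near-minimisers of the squared distance generate a filter. It is Cauchy by the
    parallelogram law, as midpoints stay in W and so have squared distance at least d; its limit is
    the nearest point. *)
Lemma nearest_point_exists W x : closed_subspace W ->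
  exists2 p, W p & forall w, W w -> `|x - p| <= `|x - w|.
Proof.
move=> hW; have W0 := closed_subspace0 hW.
pose D := [set `|x - w| ^+ 2 | w in W]; pose d := inf D.
have D0 : D (`|x - 0| ^+ 2) by exists 0.
have dD : lbound D d.
  by apply: ge_inf; exists 0 => _ [w _ <-]; exact: sqr_ge0.
have Dd e : 0 < e -> exists2 w, W w & `|x - w| ^+ 2 < d + e.
  move=> e0; have [|_ [w Ww <-] wd] := @inf_adherent _ D _ e0.
    by split; [exists (`|x - 0| ^+ 2)|exists 0 => _ [w _ <-]; exact: sqr_ge0].
  by exists w.
pose B e := [set w | W w /\ `|x - w| ^+ 2 < d + e].
pose F := filter_from [set e : R | 0 < e] B.
have FF : ProperFilter F.
  apply: filter_from_proper; last first.
    by move=> e /= /Dd [w Ww wd]; exists w.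
  apply: filter_from_filter; first by exists 1 => /=.
  move=> e e' /= e0 e'0; exists (Num.min e e') => [|w [Ww we]] /=.
    by rewrite lt_min e0.
  by split; split=> //; apply: (lt_le_trans we);
    rewrite lerD2l ge_min lexx ?orbT.
have Bdiam e w w' : B e w -> B e w' -> `|w - w'| ^+ 2 <= 4 * e.
  move=> [Ww we] [Ww' we'].
  have : d <= `|x - 2^-1 *: (w + w')| ^+ 2.
    apply: dD; exists (2^-1 *: (w + w')) => //.
    by apply: closed_subspaceZ => //; exact: closed_subspaceD.
  move: we we'; rewrite !(normBsq ip_norm) normrZ exprMn ger0_norm//.
  rewrite ipZr ipDr (normDsq ip_norm); lra.
have Fc : cvg F.
  apply: cauchy_cvg; apply: cauchy_exP => e /= e0.
  (* The diameter bound 4(e^2/5) is strictly below e^2. *)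
  have e5 : 0 < e ^+ 2 / 5 by rewrite divr_gt0// exprn_gt0.
  have [w Ww wd] := Dd _ e5.
  exists w; exists (e ^+ 2 / 5) => //= w' Bw'.
  have Bw : B (e ^+ 2 / 5) w by [].
  rewrite -ball_normE /= -(@ltr_pXn2r _ 2)// ?nnegrE// ?(ltW e0)//.
  by apply: (le_lt_trans (Bdiam _ _ _ Bw Bw')); have := exprn_gt0 2 e0; lra.
have [Wl0 WD Wc] := (closed_subspaceP W).1 hW.
exists (lim F).
  apply: (@closed_cvg _ _ F FF id W Wc _ _ Fc).
  by exists 1 => //= w [].
move=> w Ww; rewrite -(@ler_pXn2r _ 2)// ?nnegrE//.
apply: (@le_trans _ _ d); last by apply: dD; exists w.
apply/ler_addgt0Pr => e e0.
have cF : `|x - y| ^+ 2 @[y --> F] --> `|x - lim F| ^+ 2.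
  apply: (cvg_comp _ (fun r : R => r ^+ 2) (cvg_norm (cvgB (cvg_cst x) Fc))).
  exact: exprn_continuous.
apply: (@closed_cvg _ _ F FF _ _ (@closed_le _ (d + e)) _ _ cF).
by exists e => //= w' [_ /ltW].
Qed.

Section Properties.
Variable (W : set X).
Hypothesis hW : closed_subspace W.
Let P := orth_proj ip W.

Lemma orth_projP x : W (P x) /\ orthogonal_complement ip W (x - P x).
Proof.
have [p Wp xp] := nearest_point_exists x hW.
have oxp : orthogonal_complement ip W (x - p).
  move=> w Ww; set a := ip (x - p) w; set m : R := `|w| ^+ 2.
  have m0 : 0 < m + 1 by rewrite ltr_wpDl// sqr_ge0.
  (* Minimality of p against p + t w gives 0 <= t^2 m - 2 t a = -t^2 (m + 2), hence t = 0. The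
     summand 1 covers w = 0. *)
  have [t ta] : exists t : R, a = t * (m + 1).
    by exists (a / (m + 1)); rewrite divfK// gt_eqF.
  have := xp _ (closed_subspace_lin t hW Ww Wp).
  have -> : x - (t *: w + p) = (x - p) - t *: w by rewrite opprD addrCA addrC.
  rewrite -(@ler_pXn2r _ 2)// ?nnegrE// (normBsq ip_norm (x - p)).
  rewrite normrZ exprMn real_normK ?num_real// ipZr -/a -/m => h.
  have : t ^+ 2 * (m + 2) <= 0 by move: h; rewrite ta; lra.
  rewrite pmulr_lle0; last by apply: (lt_le_trans m0); rewrite lerD2l ler1n.
  by rewrite real_exprn_even_le0 ?num_real//= => /eqP t0; rewrite ta t0 mul0r.
by rewrite /P (orth_proj_unique ip_norm hW Wp oxp).
Qed.

Lemma orth_proj_in x : W (P x). Proof. by have [] := orth_projP x. Qed.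

Lemma orth_proj_orth x w : W w -> ip (P x) w = ip x w.
Proof.
have [_ h] := orth_projP x => /h /eqP.
by rewrite ipDl ipNl subr_eq0 => /eqP.
Qed.

Lemma orth_proj_id x : W x -> P x = x.
Proof.
move=> Wx; apply: orth_proj_unique => //.
by move=> w _; rewrite subrr ip0l.
Qed.

Lemma orth_proj_eq0 x : orthogonal_complement ip W x -> P x = 0.
Proof.
move=> Wx; apply: orth_proj_unique => //; first exact: closed_subspace0.
by rewrite subr0.
Qed.

Lemma orth_proj_sym x y : ip (P x) y = ip x (P y).
Proof.
rewrite ipC -(orth_proj_orth y (orth_proj_in x)) ipC.
exact/orth_proj_orth/orth_proj_in.
Qed.

Lemma orth_proj_linear : exists p : {linear X -> X}, P = p.
Proof. exact: adjointable_linear orth_proj_sym. Qed.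

Lemma normsq_orth_proj x : `|x| ^+ 2 = `|P x| ^+ 2 + `|x - P x| ^+ 2.
Proof.
rewrite (normBsq ip_norm).
by rewrite -(orth_proj_orth x (orth_proj_in x)) (ipxx ip_norm); ring.
Qed.

Lemma norm_subr_orth_proj x : `|x - P x| <= `|x|.
Proof.
by rewrite -(@ler_pXn2r _ 2)// ?nnegrE// (normsq_orth_proj x) lerDr sqr_ge0.
Qed.

Lemma norm_orth_proj x : `|P x| <= `|x|.
Proof.
by rewrite -(@ler_pXn2r _ 2)// ?nnegrE// (normsq_orth_proj x) lerDl sqr_ge0.
Qed.
End Properties.

End Projection.

(** * Powers of a normal operator and the projection onto its fixed points *)

Section NormalOperator.
Context (R : realType) (X : completeNormedModType R) (ip : {dot X for idfun}).
Hypothesis ip_norm : forall x : X, `|x| = Num.sqrt (ip x x).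
Variables (T Ts : {linear X -> X}).
Hypothesis adj : forall x y, ip (T x) y = ip x (Ts y).
Hypothesis normal : forall x, `|T x| = `|Ts x|.
Implicit Types x y : X.

Lemma adjoint_unique : adjoint ip T = Ts.
Proof.
apply/funext => y; rewrite /adjoint; apply: xget_unique => [x|z hz] /=.
  exact: adj.
by apply: (ip_inj ip_norm) => x; rewrite ipC -hz adj ipC.
Qed.

(** When T x = x, normality makes |Ts x - x|^2 = |Ts x|^2 - 2<T x, x> + |x|^2 vanish. *)
Lemma fix_adjoint x : T x = x -> Ts x = x.
Proof.
move=> Tx; apply/eqP; rewrite -subr_eq0 -normr_eq0 -sqrf_eq0 (normBsq ip_norm).
by rewrite (ipC ip (Ts x)) -adj -normal Tx ipxx//; apply/eqP; ring.
Qed.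

(* Fix T = (range (Ts - 1))^perp is closed without any boundedness assumption
   on T. *)
Lemma closed_subspace_fix : closed_subspace (Fix T).
Proof.
have -> : Fix T = orthogonal_complement ip (range (fun y => Ts y - y)).
  apply/seteqP; split=> x /= hx.
    by move=> _ [y _ <-]; rewrite ipDr ipNr -adj hx subrr.
  apply: (ip_inj ip_norm) => y; rewrite adj; apply/eqP.
  by rewrite -subr_eq0 -ipNr -ipDr hx//; exists y.
exact: closed_subspace_orthogonal.
Qed.

Let F := Fix T.
Let N := orthogonal_complement ip F.
Let P := orth_proj ip F.

Lemma orthogonal_fix_stable x : N x -> N (T x).
Proof. by move=> Nx w Fw; rewrite adj (fix_adjoint Fw) Nx. Qed.

Lemma iter_sub_proj_fix n x : iter n T x - P x = iter n T (x - P x).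
Proof.
have hP : T (P x) = P x := orth_proj_in ip_norm closed_subspace_fix x.
by elim: n => //= n <-; rewrite linearB hP.
Qed.

(** Normality gives |T y|^2 = <y, Ts T y> <= |y| |T T y|. Taking y = T^n x and multiplying by the
    induction hypothesis leaves a common factor |T^(n+1) x| to cancel. *)
Lemma norm_iter_logconvex n x :
  `|T x| * `|iter n T x| <= `|x| * `|iter n.+1 T x|.
Proof.
have step y : `|T y| ^+ 2 <= `|y| * `|T (T y)|.
  rewrite -(ipxx ip_norm) adj normal; exact: cauchy_schwarz.
elim: n => [|n IH]; first by rewrite /= mulrC.
have := step (iter n T x); rewrite -!iterS => h.
have [->|y0] := eqVneq (iter n.+1 T x) 0.
  by rewrite normr0 mulr0 mulr_ge0.
have yp : 0 < `|iter n.+1 T x| by rewrite normr_gt0.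
rewrite -(ler_pM2r yp) -mulrA -expr2.
apply: (le_trans (ler_wpM2l (normr_ge0 _) h)).
rewrite mulrA (le_trans (ler_wpM2r (normr_ge0 _) IH))//.
by rewrite -!mulrA ler_wpM2l// mulrC.
Qed.

Lemma norm_exp_le_iter n x : `|x| <= 1 -> `|T x| ^+ n.+1 <= `|iter n.+1 T x|.
Proof.
move=> x1; elim: n => [|n IH]; first by rewrite expr1.
rewrite exprS; apply: (le_trans (ler_wpM2l (normr_ge0 _) IH)).
apply: (le_trans (norm_iter_logconvex _ _)).
by rewrite ler_piMl.
Qed.

Variable c : R.
Hypothesis c0 : 0 <= c.
Hypothesis c_upper : forall x, N x -> `|T x| <= c * `|x|.

Lemma norm_iter_sub_proj n x :
  `|iter n T x - P x| <= c ^+ n * `|x - P x|.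
Proof.
rewrite iter_sub_proj_fix.
have [_] := orth_projP ip_norm closed_subspace_fix x.
rewrite -/F -/P -/N; move: (x - P x) => y Ny.
have [] : N (iter n T y) /\ `|iter n T y| <= c ^+ n * `|y|; last by [].
elim: n => [|n [Nn IH]]; first by rewrite expr0 mul1r.
split; first exact: orthogonal_fix_stable.
rewrite exprS -mulrA; apply: (le_trans (c_upper Nn)).
exact: ler_wpM2l.
Qed.

Hypothesis c_lower :
  forall r, r < c -> exists x, [/\ N x, `|x| <= 1 & r < `|T x|].

(** If the norm were some m < c^n, the n-th root r of m would be below c; [c_lower] then yields x in
    N with |x| <= 1 and |T^n x| >= |T x|^n > m, while P x = 0. *)
Lemma op_norm_iter_sub_proj n : (0 < n)%N ->
  op_norm (fun x => iter n T x - P x) = (c ^+ n)%:E.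
Proof.
case: n => // n _; apply/eqP; rewrite eq_le; apply/andP; split.
  apply: ge_ereal_sup => _ [x /= x1 <-]; rewrite lee_fin.
  apply: (le_trans (norm_iter_sub_proj n.+1 x)).
  rewrite -[leRHS]mulr1 ler_wpM2l ?exprn_ge0//.
  exact: le_trans (norm_subr_orth_proj ip_norm closed_subspace_fix _) x1.
rewrite leNgt; apply/negP => lt_c.
have ub x : `|x| <= 1 ->
    ((`|iter n.+1 T x - P x|)%R%:E
      <= op_norm (fun x => iter n.+1 T x - P x)%R)%E.
  by move=> x1; apply: ereal_sup_ubound; exists x.
move: lt_c ub; case: (op_norm _) => [m| |] lt_c ub.
- have m0 : 0 <= m.
    have := ub 0; rewrite normr0 lee_fin ler01 => /(_ isT).
    exact: le_trans.
  pose r := m `^ (n.+1%:R^-1).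
  have rm : r ^+ n.+1 = m.
    by rewrite -powR_mulrn ?powR_ge0// -powRrM mulVf ?pnatr_eq0// powRr1.
  have r0 : 0 <= r by exact: powR_ge0.
  have rc : r < c by rewrite -(@ltr_pXn2r _ n.+1)// ?nnegrE// rm.
  have [x [Nx x1 rx]] := c_lower rc.
  have := ub x x1.
  rewrite /P orth_proj_eq0// ?subr0; last exact: closed_subspace_fix.
  rewrite lee_fin -rm => /(le_trans (norm_exp_le_iter n x1)).
  by rewrite leNgt ltrXn2r.
- by have := lt_c; rewrite ltNge leey.
- by have := ub 0; rewrite normr0 ler01 => /(_ isT).
Qed.
End NormalOperator.

(** * The Friedrichs angle as a supremum *)

Lemma friedrichs_cosC (R : realType) (X : normedModType R)
  (ip : {dot X for idfun}) (U V : set X) :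
  friedrichs_cos ip U V = friedrichs_cos ip V U.
Proof.
rewrite /friedrichs_cos (setIC U V); congr (sup _).
by apply/seteqP; split=> _ /= [u [v [? ? ? ? ->]]]; exists v, u; split=> //;
  rewrite ipC.
Qed.

Section FriedrichsAngle.
Context (R : realType) (X : completeNormedModType R) (ip : {dot X for idfun}).
Hypothesis ip_norm : forall x : X, `|x| = Num.sqrt (ip x x).
Variables U V : set X.
Hypotheses (hU : closed_subspace U) (hV : closed_subspace V).
Implicit Types x y u v : X.

Notation perp := (orthogonal_complement ip).
Let p := orth_proj ip U.
Let q := orth_proj ip V.
Let c := friedrichs_cos ip U V.

Let cosines := [set r | exists u v : X,
  [/\ (U `&` perp (U `&` V)) u, (V `&` perp (U `&` V)) v,
      `|u| <= 1, `|v| <= 1 & r = ip u v]].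

Let cosines_ubound : ubound cosines 1.
Proof.
move=> _ [u [v [_ _ u1 v1 ->]]].
by rewrite (le_trans (cauchy_schwarz ip_norm _ _))// mulr_ile1.
Qed.

Let cosines0 : cosines 0.
Proof.
exists 0, 0; rewrite normr0 ip0l; split=> //; split.
- exact: closed_subspace0.
- by move=> w _; rewrite ip0l.
- exact: closed_subspace0.
- by move=> w _; rewrite ip0l.
Qed.

Lemma friedrichs_cos_ge0 : 0 <= c.
Proof. by apply: ub_le_sup => //; exists 1. Qed.

Lemma friedrichs_cos_le1 : c <= 1.
Proof. by apply: ge_sup => //; exists 0. Qed.

Lemma friedrichs_cos_adherent r : r < c -> exists u v,
  [/\ (U `&` perp (U `&` V)) u, (V `&` perp (U `&` V)) v,
      `|u| <= 1, `|v| <= 1 & r < ip u v].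
Proof.
rewrite -subr_gt0 => rc.
have [|_ [u [v [Uu Vv u1 v1 ->]]] cr] := @sup_adherent _ cosines _ rc.
  by split; [exists 0|exists 1].
by exists u, v; split=> //; move: cr; rewrite opprB addrC subrK.
Qed.

Lemma ip_le_friedrichs_cos u v : (U `&` perp (U `&` V)) u ->
  (V `&` perp (U `&` V)) v -> ip u v <= c * (`|u| * `|v|).
Proof.
move=> [Uu Nu] [Vv Nv].
have [->|u0] := eqVneq u 0; first by rewrite ip0l normr0 mul0r mulr0.
have [->|v0] := eqVneq v 0; first by rewrite ip0r normr0 !mulr0.
have uvp : 0 < `|u| * `|v| by rewrite mulr_gt0 ?normr_gt0.
rewrite -ler_pdivrMr//.
apply: ub_le_sup; first by exists 1.
have unit y : y != 0 -> `| `|y|^-1 *: y| <= 1.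
  by move=> y0; rewrite normrZ normfV normr_id mulVf// normr_eq0.
have hN := closed_subspace_orthogonal ip_norm (U `&` V).
exists (`|u|^-1 *: u), (`|v|^-1 *: v).
split; [split|split|exact: unit|exact: unit|].
- exact: closed_subspaceZ.
- exact: (@closed_subspaceZ _ _ _ _ _ hN).
- exact: closed_subspaceZ.
- exact: (@closed_subspaceZ _ _ _ _ _ hN).
by rewrite ipZl ipZr invfM mulrA mulrC.
Qed.

Lemma orth_proj_stable (W W' : set X) x : closed_subspace W -> W' `<=` W ->
  perp W' x -> perp W' (orth_proj ip W x).
Proof. by move=> hW sW Nx w W'w; rewrite orth_proj_orth ?Nx//; exact: sW. Qed.

(** Since q u stays orthogonal to U & V, |q u|^2 = <u, q u> <= c |u| |q u|; then divide by |q u|. *)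
Lemma norm_orth_proj_friedrichs u :
  (U `&` perp (U `&` V)) u -> `|q u| <= c * `|u|.
Proof.
move=> [Uu Nu].
have Vqu : V (q u) := orth_proj_in ip_norm hV u.
have [->|qu0] := eqVneq (q u) 0.
  by rewrite normr0 mulr_ge0// friedrichs_cos_ge0.
have qup : 0 < `|q u| by rewrite normr_gt0.
rewrite -(ler_pM2r qup) -expr2 -(ipxx ip_norm) {1}/q orth_proj_orth// -mulrA.
apply: ip_le_friedrichs_cos; split=> //.
by apply: orth_proj_stable => // w [].
Qed.
End FriedrichsAngle.

(** * The same cosine bound for the orthogonal complements *)

Section ComplementaryAngle.
Context (R : realType) (X : completeNormedModType R) (ip : {dot X for idfun}).
Hypothesis ip_norm : forall x : X, `|x| = Num.sqrt (ip x x).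
Variables U V : set X.
Hypotheses (hU : closed_subspace U) (hV : closed_subspace V).

Notation perp := (orthogonal_complement ip).
Let p := orth_proj ip U.
Let q := orth_proj ip V.
Let c := friedrichs_cos ip U V.

Let c0 : 0 <= c. Proof. exact: friedrichs_cos_ge0. Qed.

Let c1 : 0 <= 1 - c ^+ 2.
Proof. by rewrite subr_ge0 exprn_ile1// friedrichs_cos_le1. Qed.

(** Let m be the projection of u onto the closure of (1 - p) V. Then u - m is orthogonal to U, as u
    and m both are, and to V, by v = (v - p v) + p v. Hence u - m is orthogonal to u by hypothesis
    and to m by construction, so it is 0. *)
Lemma dense_range_sub_proj u : perp U u -> perp (perp U `&` perp V) u ->
  closure [set v - p v | v in V] u.
Proof.
move=> Uu UVu; set M := [set v - p v | v in V].
have [p' pE] := orth_proj_linear ip_norm hU.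
have hM : closed_subspace (closure M).
  apply: closed_subspace_closure.
    by exists 0; [exact: closed_subspace0|rewrite /p pE linear0 subr0].
  move=> a _ _ [x Vx <-] [y Vy <-]; exists (a *: x + y).
    exact: closed_subspace_lin.
  by rewrite /p pE linearP scalerBr opprD addrACA.
have perpU : closed (perp U).
  by have [] := (closed_subspaceP _).1 (closed_subspace_orthogonal ip_norm U).
have M_perpU : closure M `<=` perp U.
  move=> x Mx; apply: perpU; move: x Mx; apply: closure_subset => _ [v _ <-].
  by have [] := orth_projP ip_norm hU v.
have [Mm yM] := orth_projP ip_norm hM u.
set m := orth_proj ip (closure M) u in Mm yM.
have Uy : perp U (u - m).
  move=> w Uw; rewrite ipDl ipNl Uu//.
  by rewrite (M_perpU _ Mm)// subrr.
have Vy : perp V (u - m).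
  move=> v Vv; rewrite -[v](subrK (p v)) ipDr yM.
    by rewrite (Uy (p v))// ?addr0//; exact: (orth_proj_in ip_norm hU).
  by apply: subset_closure; exists v.
suff /eqP : ip (u - m) (u - m) = 0.
  by rewrite (ipxx ip_norm) sqrf_eq0 normr_eq0 subr_eq0 => /eqP ->.
rewrite [LHS]ipDr ipNr (yM _ Mm) subr0 ipC.
exact: UVu.
Qed.

(* For v in V orthogonal to U & V, Pythagoras gives
   |m|^2 = |v|^2 - |p v|^2 >= (1 - c^2) |v|^2, while
   |m|^2 = <q m, v> <= |q m| |v|. *)
Lemma norm_sub_proj_lower m : [set v - p v | v in V] m ->
  (1 - c ^+ 2) * `|m| ^+ 2 <= `|q m| ^+ 2.
Proof.
move=> [v Vv <-]; set m' := v - p v.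
have hW := closed_subspaceI hU hV.
pose v' := v - orth_proj ip (U `&` V) v.
have [[Uw Vw] Nv'] := orth_projP ip_norm hW v.
have Vv' : V v' by exact: closed_subspaceB.
(* Since p fixes the component of v in U & V, dropping it leaves v - p v unchanged. *)
have m'E : m' = v' - p v'.
  have [p' pE] := orth_proj_linear ip_norm hU.
  rewrite /v' /m' /p pE linearB -pE (orth_proj_id ip_norm hU Uw).
  by rewrite opprB addrA subrK.
have pv' : `|p v'| <= c * `|v'|.
  rewrite /c friedrichs_cosC; apply: (norm_orth_proj_friedrichs ip_norm hV hU).
  by rewrite (setIC V U).
have pyth := normsq_orth_proj ip_norm hU v'.
have m'sq : `|m'| ^+ 2 <= `|q m'| * `|v'|.
  rewrite -(ipxx ip_norm) {2}m'E ipDr ipNr.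
  have m'pv : ip m' (p v') = 0.
    by have [_] := orth_projP ip_norm hU v; apply; exact: orth_proj_in.
  rewrite m'pv subr0 -(orth_proj_orth ip_norm hV _ Vv'); exact: cauchy_schwarz.
rewrite -/p -m'E in pyth.
have [->|m'0] := eqVneq m' 0.
  by rewrite normr0 expr0n mulr0 sqr_ge0.
have m'p : 0 < `|m'| ^+ 2 by rewrite exprn_gt0// normr_gt0.
have vm : (1 - c ^+ 2) * `|v'| ^+ 2 <= `|m'| ^+ 2.
  have : `|p v'| ^+ 2 <= (c * `|v'|) ^+ 2.
    by rewrite ler_pXn2r// ?nnegrE ?mulr_ge0// ?c0.
  by rewrite exprMn; lra.
rewrite -(ler_pM2r m'p) -mulrA.
apply: (@le_trans _ _ ((1 - c ^+ 2) * (`|q m'| * `|v'|) ^+ 2)).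
  by rewrite ler_wpM2l// -expr2 ler_pXn2r// ?nnegrE ?mulr_ge0.
by rewrite exprMn mulrCA ler_wpM2l// sqr_ge0.
Qed.

(* This is the nontrivial half of c_F(U^perp, V^perp) = c_F(U, V). *)
Lemma norm_sub_orth_proj_friedrichs u :
  perp U u -> perp (perp U `&` perp V) u -> `|u - q u| <= c * `|u|.
Proof.
move=> Uu UVu; set s := Num.sqrt (1 - c ^+ 2).
have s1 : s <= 1.
  by rewrite -[leRHS]sqrtr1 ler_sqrt// gerBl sqr_ge0.
(* The bound holds on (1 - p) V. Replacing u by m within e/2 costs at most e/2 on each side, as s <=
   1 and q does not increase norms. *)
have squ : s * `|u| <= `|q u|.
  apply/ler_addgt0Pr => e e0.
  have /closure_normP/(_ (e / 2)) := dense_range_sub_proj Uu UVu.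
  rewrite divr_gt0// => /(_ isT) [m Mm um].
  have smq : s * `|m| <= `|q m|.
    rewrite -(@ler_pXn2r _ 2)// ?nnegrE ?mulr_ge0 ?sqrtr_ge0//.
    by rewrite exprMn sqr_sqrtr// norm_sub_proj_lower.
  have qmu : `|q m| <= `|q u| + `|u - m|.
    have [q' qE] := orth_proj_linear ip_norm hV.
    have -> : q m = q u - q (u - m) by rewrite /q qE linearB subKr.
    by rewrite (le_trans (ler_normB _ _))// lerD2l norm_orth_proj.
  have su : s * `|u| <= s * `|m| + `|u - m|.
    have : s * `|u| <= s * (`|m| + `|u - m|).
      by rewrite ler_wpM2l ?sqrtr_ge0// -lerBlDl (le_trans (lerB_dist _ _)).
    have : s * `|u - m| <= `|u - m| by rewrite ler_piMl.
    by lra.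
  by lra.
rewrite -(@ler_pXn2r _ 2)// ?nnegrE ?mulr_ge0 ?c0//.
have : (s * `|u|) ^+ 2 <= `|q u| ^+ 2.
  by rewrite ler_pXn2r// ?nnegrE ?mulr_ge0// ?sqrtr_ge0.
rewrite !exprMn sqr_sqrtr// (normsq_orth_proj ip_norm hV u) -/q.
by lra.
Qed.
End ComplementaryAngle.

(** * The Douglas-Rachford operator: adjoint, fixed points and norm bounds *)

Section DouglasRachford.
Context (R : realType) (X : completeNormedModType R) (ip : {dot X for idfun}).
Hypothesis ip_norm : forall x : X, `|x| = Num.sqrt (ip x x).
Variables U V : set X.
Hypotheses (hU : closed_subspace U) (hV : closed_subspace V).
Implicit Types x y : X.

Notation perp := (orthogonal_complement ip).
Let p := orth_proj ip U.
Let q := orth_proj ip V.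
Let T := douglas_rachford ip U V.

(** Expanded, T = 2 q p - p - q + 1 with p and q symmetric, so taking the adjoint only reverses the
    product q p. *)
Lemma douglas_rachford_adj x y : ip (T x) y = ip x (douglas_rachford ip V U y).
Proof.
rewrite /T /douglas_rachford !(ipDr, ipNr, ipDl, ipNl).
rewrite (orth_proj_sym ip_norm hV) -(orth_proj_sym ip_norm hU).
rewrite !(ipDr, ipNr, ipDl, ipNl, ipZl, ipZr).
by ring.
Qed.

(** This splits T x into a vector of V and one orthogonal to V, ready for Pythagoras. *)
Lemma douglas_rachfordE x : T x = q (p x) + ((x - p x) - q (x - p x)).
Proof.
rewrite /T /douglas_rachford -/p -/q.
have [q' qE] := orth_proj_linear ip_norm hV.
have -> : 2 *: p x - x = p x - (x - p x).
  by rewrite opprB addrA scaler_nat mulr2n.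
rewrite /q qE (linearB q' (p x)) -!addrA; congr (_ + _).
by rewrite addrC -addrA.
Qed.

Lemma normsq_douglas_rachford x :
  `|T x| ^+ 2 = `|q (p x)| ^+ 2 + `|(x - p x) - q (x - p x)| ^+ 2.
Proof.
rewrite douglas_rachfordE (normDsq ip_norm) ipC.
have [_ ->] := orth_projP ip_norm hV (x - p x).
  by rewrite mulr0 addr0.
exact: orth_proj_in.
Qed.

(** With a = p x and b = x - a, both sides equal |q a|^2 + |b|^2 - |q b|^2. The symmetry of the loss
    in p and q yields normality, and its vanishing characterises fixed points. *)
Lemma normsq_douglas_rachford_loss x :
  `|T x| ^+ 2 = `|x| ^+ 2 - `|p x - q x| ^+ 2.
Proof.
rewrite normsq_douglas_rachford (normsq_orth_proj ip_norm hU x) -/p.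
set a := p x; set b := x - a.
have [q' qE] := orth_proj_linear ip_norm hV.
have qx : q x = q a + q b by rewrite /q qE -linearD /= addrC subrK.
have aq : ip a (q x) = `|q a| ^+ 2 + ip (q a) (q b).
  rewrite -(orth_proj_orth ip_norm hV); last exact: orth_proj_in.
  by rewrite -/q qx ipDr (ipxx ip_norm).
rewrite (normsq_orth_proj ip_norm hV b) -/q (normBsq ip_norm a) aq qx.
by rewrite (normDsq ip_norm (q a)); ring.
Qed.

Lemma fix_douglas_rachfordP x : T x = x <-> p x = q x.
Proof.
split=> [Tx|pq].
  have := normsq_douglas_rachford_loss x; rewrite Tx => /esym/eqP.
  rewrite addrC -subr_eq0 addrK oppr_eq0 sqrf_eq0 normr_eq0 subr_eq0.
  exact/eqP.
have [q' qE] := orth_proj_linear ip_norm hV.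
have qq : q (q x) = q x by apply: orth_proj_id => //; exact: orth_proj_in.
rewrite douglas_rachfordE pq qq.
have -> : q (x - q x) = 0 by rewrite {1}/q qE linearB -qE -/q qq subrr.
by rewrite subr0 addrC subrK.
Qed.

(** Both U & V and U^perp & V^perp consist of fixed points, so p x and x - p x meet the hypotheses
    of the two angle bounds. Pythagoras recombines the halves. *)
Lemma douglas_rachford_upper x :
  perp (Fix T) x -> `|T x| <= friedrichs_cos ip U V * `|x|.
Proof.
move=> Nx; set c := friedrichs_cos ip U V.
have c0 : 0 <= c := friedrichs_cos_ge0 ip_norm hU hV.
have Npx : perp (U `&` V) (p x).
  apply: orth_proj_stable => // w [Uw Vw]; apply: Nx.
  by apply/fix_douglas_rachfordP; rewrite /p /q !orth_proj_id.
have NUV : perp (perp U `&` perp V) (x - p x).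
  move=> w [Uw Vw]; rewrite ipDl ipNl.
  have -> : ip x w = 0.
    by apply: Nx; apply/fix_douglas_rachfordP; rewrite /p /q !orth_proj_eq0.
  by rewrite ipC Uw ?subr0//; exact: orth_proj_in.
have [_ Uxp] := orth_projP ip_norm hU x.
have h1 : `|q (p x)| <= c * `|p x|.
  apply: norm_orth_proj_friedrichs => //; split=> //; exact: orth_proj_in.
have h2 : `|(x - p x) - q (x - p x)| <= c * `|x - p x|.
  exact: norm_sub_orth_proj_friedrichs.
rewrite -(@ler_pXn2r _ 2)// ?nnegrE ?mulr_ge0//.
rewrite normsq_douglas_rachford exprMn (normsq_orth_proj ip_norm hU x) mulrDr.
by rewrite -!exprMn lerD// ler_pXn2r// ?nnegrE ?mulr_ge0.
Qed.

Lemma douglas_rachford_lower r : r < friedrichs_cos ip U V ->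
  exists x, [/\ perp (Fix T) x, `|x| <= 1 & r < `|T x|].
Proof.
move=> /(friedrichs_cos_adherent ip_norm hU hV).
move=> [u [v [[Uu Nu] [Vv _] u1 v1 ruv]]].
have pu : p u = u by exact: orth_proj_id.
exists u; split=> //.
  (* For a fixed point w, <u, w> = <u, p w>, and p w = q w lies in U & V. *)
  move=> w /fix_douglas_rachfordP pqw; rewrite -pu (orth_proj_sym ip_norm hU).
  apply: Nu; split; first exact: orth_proj_in.
  rewrite -/p pqw; exact: orth_proj_in.
apply: (lt_le_trans ruv).
have -> : T u = q u.
  rewrite douglas_rachfordE pu subrr.
  have -> : q 0 = 0 by apply: orth_proj_id => //; exact: closed_subspace0.
  by rewrite subr0 addr0.
rewrite -(orth_proj_orth ip_norm hV _ Vv).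
apply: (le_trans (cauchy_schwarz ip_norm _ _)).
by rewrite ler_piMr.
Qed.
End DouglasRachford.

Lemma norm_douglas_rachfordC (R : realType) (X : completeNormedModType R)
    (ip : {dot X for idfun}) (ip_norm : forall x : X, `|x| = Num.sqrt (ip x x))
    (U V : set X) (hU : closed_subspace U) (hV : closed_subspace V) (x : X) :
  `|douglas_rachford ip U V x| = `|douglas_rachford ip V U x|.
Proof. by apply: norm_eq; rewrite !normsq_douglas_rachford_loss// distrC. Qed.

(** * Norms for T and T T^*, and the pointwise estimate *)

Theorem theorem4p1 (R : realType) (X : completeNormedModType R)
    (ip : {dot X for idfun}) (ip_norm : forall x : X, `|x| = Num.sqrt (ip x x))
    (U V : set X) (hU : closed_subspace U) (hV : closed_subspace V)
    (n : nat) (hn : (1 <= n)%N) (x : X) :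
  let T := douglas_rachford ip U V in
  let PFix := orth_proj ip (Fix T) in
  let cF := friedrichs_cos ip U V in
  [/\ op_norm (fun y : X => iter n T y - PFix y) = (cF ^+ n)%:E,
      op_norm (fun y : X => iter n (T \o adjoint ip T) y - PFix y)
        = (cF ^+ (2 * n))%:E &
      `|iter n T x - PFix x| <= cF ^+ n * `|x - PFix x| <= cF ^+ n * `|x|].
Proof.
move=> T PFix cF.
pose Ts := douglas_rachford ip V U.
have adj y z : ip (T y) z = ip y (Ts z) by exact: douglas_rachford_adj.
have adj' y z : ip (Ts y) z = ip y (T z) by rewrite ipC -adj ipC.
have normal y : `|T y| = `|Ts y| by exact: norm_douglas_rachfordC.
have upper := douglas_rachford_upper ip_norm hU hV.
have lower := douglas_rachford_lower ip_norm hU hV.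
have cF0 : 0 <= cF := friedrichs_cos_ge0 ip_norm hU hV.
pose S := T \o Ts.
have adjS y z : ip (S y) z = ip y (S z) by rewrite /S /= adj adj'.
have Ts_fix y : T y = y -> Ts y = y.
  move=> /(fix_douglas_rachfordP ip_norm hU hV)/esym.
  by move=> /(fix_douglas_rachfordP ip_norm hV hU).
(* If T Ts y = y, then |Ts y|^2 = <y, T Ts y> = |y|^2, so the loss of Ts at y is zero. *)
have fixS : Fix S = Fix T.
  apply/seteqP; split=> y; rewrite /Fix /S /=.
    2: by move=> Ty; rewrite Ts_fix.
  move=> Sy; apply/(fix_douglas_rachfordP ip_norm hU hV)/esym/eqP.
  have := normsq_douglas_rachford_loss ip_norm hV hU y.
  rewrite -(ipxx ip_norm) adj' Sy (ipxx ip_norm) => /esym/eqP.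
  by rewrite addrC -subr_eq0 addrK oppr_eq0 sqrf_eq0 normr_eq0 subr_eq0.
have upperS y : orthogonal_complement ip (Fix S) y -> `|S y| <= cF ^+ 2 * `|y|.
  rewrite fixS => Ny; rewrite expr2 -mulrA.
  have NTs : orthogonal_complement ip (Fix T) (Ts y).
    by move=> w Tw; rewrite adj' Tw Ny.
  apply: (le_trans (upper _ NTs)); rewrite ler_wpM2l// -/Ts -normal.
  exact: upper.
have lowerS r : r < cF ^+ 2 -> exists y,
    [/\ orthogonal_complement ip (Fix S) y, `|y| <= 1 & r < `|S y|].
  rewrite fixS => rc.
  have [r0|r0] := ltP r 0.
    exists 0; rewrite normr0; split=> // [w _|]; first by rewrite ip0l.
    exact: lt_le_trans r0 _.
  (* A y with |T y| above the root of r suffices: r < |T y|^2 = |Ts y|^2 = <y, S y> <= |S y|. *)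
  have [|y [Ny y1 ry]] := lower (Num.sqrt r).
    by rewrite -(@ltr_pXn2r _ 2)// ?nnegrE ?sqrtr_ge0// sqr_sqrtr.
  exists y; split=> //.
  have : r < `|Ts y| ^+ 2.
    by rewrite -normal -(sqr_sqrtr r0) ltr_pXn2r// ?nnegrE ?sqrtr_ge0.
  move=> /lt_le_trans; apply; rewrite -(ipxx ip_norm) adj'.
  by rewrite (le_trans (cauchy_schwarz ip_norm _ _))// ler_piMl.
have [t tE] : exists h : {linear X -> X}, T = h
  := adjointable_linear ip_norm adj.
have [ts tsE] : exists h : {linear X -> X}, Ts = h
  := adjointable_linear ip_norm adj'.
have [s sE] : exists h : {linear X -> X}, S = h
  := adjointable_linear ip_norm adjS.
have adjt y z : ip (t y) z = ip y (ts z) by rewrite -tE -tsE.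
have normalt y : `|t y| = `|ts y| by rewrite -tE -tsE.
have -> : adjoint ip T = Ts.
  by rewrite tE tsE; exact: adjoint_unique.
split.
- have := op_norm_iter_sub_proj ip_norm adjt normalt cF0.
  by rewrite -tE; apply.
- have adjs y z : ip (s y) z = ip y (s z) by rewrite -sE.
  (* S is its own adjoint, so normality is trivial; the constant is [cF ^+ 2]. *)
  have := op_norm_iter_sub_proj ip_norm adjs (fun=> erefl) (exprn_ge0 2 cF0).
  by rewrite -sE /PFix -fixS exprM; apply.
- have := norm_iter_sub_proj ip_norm adjt normalt cF0.
  rewrite -tE => ->//=; rewrite ler_wpM2l ?exprn_ge0// norm_subr_orth_proj//.
  by rewrite tE; exact: (closed_subspace_fix ip_norm adjt).
Qed.
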